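(* Let $f:\Sigma\to\Sigma$ be a measurable invertible map on a topological space $\Sigma$ preserving an ergodic probability measure $\mu$, and let $\tau$ be a $\mu$-integrable roof function on $\Sigma$ that is bounded away from zero. Let $(X_t)_t$ be the suspension semiflow over $(f,\mu,\tau)$ on $\Sigma_\tau$ and let $\bar\mu$ be the corresponding $(X_t)_t$-invariant probability measure $\bar\mu=\frac{(\mu\times m)|_{\Sigma_\tau}}{\int_\Sigma\tau\,d\mu}$. Let $A=I\times[t_1,t_2]\subset\Sigma\times[0,\infty)$ be a cylinder set in $\Sigma_\tau$ (so $I\subset\Sigma$, $0\le t_1<t_2$ and $t_2\le\tau(x)$ for every $x\in I$) with positive $\bar\mu$-measure. Then $$ \int_A n_A(x,t)\,d\bar\mu_A=\int_A e_A(x,t)\,d\bar\mu_A+\big(1-\bar\mu(A)\big)\frac{1}{\mu(I)}\int_\Sigma\tau\,d\mu =\frac{m([t_1,t_2])}{2}+\frac{1}{\mu(I)}\int_\Sigma\Big(\tau-(t_2-t_1)\chi_I\Big)\,d\mu . $$ In particular, if the set $A$ is kept unchanged and the roof function $\tau$ is changed, the mean return time $\int_A n_A(x,t)\,d\bar\mu_A$ varies linearly with respect to the mean $\int_\Sigma\tau\,d\mu$ of the roof function.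
   Context: Suspension: given a measurable map $f:\Sigma\to\Sigma$ and a roof function $\tau$ on $\Sigma$, positive and bounded away from zero, let $\Sigma_\tau=\{(x,s)\in\Sigma\times[0,\infty):0\le s\le\tau(x)\}/\sim$, where $(x,\tau(x))\sim(f(x),0)$ for every $x\in\Sigma$. The suspension (semi)flow $(X_s)_s$ on $\Sigma_\tau$ is $$X_s(x,t)=\Big(f^k(x),\,t+s-\sum_{j=0}^{k-1}\tau(f^j(x))\Big),$$ where $k=k(x,t,s)\ge0$ is determined by $\sum_{j=0}^{k-1}\tau(f^j(x))\le t+s<\sum_{j=0}^{k}\tau(f^j(x))$. $m$ denotes Lebesgue measure on $\mathbb R$ and $\chi_I$ the indicator function of $I$. $\bar\mu_A(\cdot)=\bar\mu(\cdot\cap A)/\bar\mu(A)$ is the normalized restriction of $\bar\mu$ to $A$. For $A\subset\Sigma_\tau$, the escape time is $e_A(x,t)=\inf\{s>0:X_s(x,t)\notin A\}$, and the hitting time (whose restriction to $A$ is the return time) is $n_A(x,t)=\inf\{s>e_A(x,t):X_s(x,t)\in A\}$.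
   Formalization: Adds that, when t1 = 0, the set of x in I with f(x) in I and τ(x) = t2 has μ-measure zero; otherwise the second equality fails (e.g. I = Σ, t1 = 0, τ constant equal to t2 gives A = Σ_τ and infinite times). *)

(* Defs.v *)
From HB Require Import structures.
From Stdlib Require Import Relation_Operators.
From mathcomp Require Import all_boot all_order all_algebra.
From mathcomp Require Import generic_quotient.
From mathcomp Require Import all_classical all_reals all_analysis.
From mathcomp Require Import measurable_realfun.

Set Implicit Arguments.
Unset Strict Implicit.
Unset Printing Implicit Defensive.

Import Order.TTheory GRing.Theory Num.Theory.
Import numFieldNormedType.Exports.

Local Open Scope classical_set_scope.
Local Open Scope ring_scope.
Local Open Scope quotient_scope.

(* A topological space as a measurable space, with its Borel sigma-algebra. *)
Notation borel X := (g_sigma_algebraType (@open X)).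

Section Base.
Context d (T : measurableType d) (R : realType).
Implicit Types (f : T -> T) (mu : set T -> \bar R).

Definition bimeasurable f :=
  measurable_fun [set: T] f /\
  exists2 g : T -> T, measurable_fun [set: T] g & cancel f g /\ cancel g f.

Definition preserves f mu :=
  forall B, measurable B -> mu (f @^-1` B) = mu B.

Definition ergodic f mu :=
  forall B, measurable B -> f @^-1` B = B -> mu B = 0%E \/ mu B = 1%E.

(* Only a measure when [A] is measurable with [0 < mu A < +oo]. *)
Definition normrestr mu (A : set T) : set T -> \bar R :=
  fun B => (mu (B `&` A) / mu A)%E.

Record roof := Roof {
  roof_fun :> T -> R;
  measurable_roof : measurable_fun [set: T] roof_fun;
  roof_bounded : exists2 c : R, 0 < c & forall x, c <= roof_fun x }.

Lemma roof_gt0 (tau : roof) x : 0 < tau x.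
Proof. by case: (roof_bounded tau) => c c0 /(_ x); exact: lt_le_trans. Qed.

End Base.

Arguments roof {d} T R.

Section Suspension.
Context d (T : measurableType d) (R : realType).
Variables (f : T -> T) (tau : roof T R).

Definition under_roof : pred (T * R) := fun p => 0 <= p.2 <= tau p.1.

Lemma under_roof_base x : under_roof (x, 0).
Proof. by rewrite /under_roof /= lexx ltW ?roof_gt0. Qed.

Definition region := {p : T * R | under_roof p}.

Definition glue (p q : region) : Prop :=
  (val p).2 = tau (val p).1 /\ val q = (f (val p).1, 0).

Definition susp_rel : rel region :=
  fun p q => `[< clos_refl_sym_trans region glue p q >].

Lemma susp_rel_refl : reflexive susp_rel.
Proof. by move=> p; apply/asboolP; exact: rst_refl. Qed.

Lemma susp_rel_sym : symmetric susp_rel.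
Proof. by move=> p q; apply/asboolP/asboolP; exact: rst_sym. Qed.

Lemma susp_rel_trans : transitive susp_rel.
Proof.
by move=> q p r /asboolP pq /asboolP qr; apply/asboolP; exact: rst_trans pq qr.
Qed.

Canonical susp_equiv := EquivRel susp_rel susp_rel_refl susp_rel_sym susp_rel_trans.

Definition susp := {eq_quot susp_equiv}.

HB.instance Definition _ := EqQuotient.on susp.
HB.instance Definition _ := Choice.on susp.
HB.instance Definition _ :=
  isPointed.Build susp (\pi_susp (exist _ (point, 0) (under_roof_base point))).

(* The quotient map, with a dummy value off the region under the roof. *)
Definition susp_pi (p : T * R) : susp :=
  if insub p is Some q then \pi_susp (q : region) else point.

Lemma measurable_under_roof : measurable [set p | under_roof p].
Proof.
have -> : [set p | under_roof p] =
    [set p : T * R | 0 <= p.2] `&` [set p : T * R | p.2 <= tau p.1].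
  by apply/seteqP; split=> p /=; rewrite /under_roof; [move/andP|move=> ?; apply/andP].
apply: measurableI; rewrite -[X in measurable X]setTI.
  by apply: measurable_fun_ler => //; exact: measurable_snd.
apply: measurable_fun_ler => //.
exact: (measurableT_comp (measurable_roof tau) measurable_fst).
Qed.

Lemma susp_sigma_algebra : sigma_algebra [set: susp]
  (image_set_system [set p | under_roof p] susp_pi measurable).
Proof.
apply: sigma_algebra_image; split => //.
- by move=> A mA; apply: measurableD => //; exact: measurable_under_roof.
- by move=> F mF; exact: bigcup_measurable.
Qed.

(* Quotient sigma-algebra: [B] is measurable iff the set of all representatives
   of its points, [{p | under_roof p} `&` susp_pi @^-1` B], is measurable in the
   product. *)
HB.instance Definition _ := @isMeasurable.Build default_measure_display susp
  (image_set_system [set p | under_roof p] susp_pi measurable)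
  (let: And3 h _ _ := susp_sigma_algebra in h)
  (fun A mA => eq_ind _ _ (let: And3 _ h _ := susp_sigma_algebra in h A mA)
     _ (setTD A))
  (let: And3 _ _ h := susp_sigma_algebra in h).

(* The points of the identified curves are counted with all their
   representatives; these form a null set of the product measure. *)
Definition susp_measure (mu : set T -> \bar R) (B : set susp) : \bar R :=
  ((mu \x @lebesgue_measure R) ([set p | under_roof p] `&` susp_pi @^-1` B)
     / \int[mu]_x (tau x)%:E)%E.

Section Measure.
Variable mu : probability T R.
Let m := susp_measure mu.

Let mE : exists r : {nonneg R}, m = (fun B => r%:num%:E *
  (mu \x @lebesgue_measure R)%E ([set p | under_roof p] `&` susp_pi @^-1` B))%E.
Proof.
have i0 : (0 < \int[mu]_x (tau x)%:E)%E.
  have [c c0 cle] := roof_bounded tau.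
  apply: (@lt_le_trans _ _ (\int[mu]_(x in [set: T]) (c%:E))%E).
    by rewrite integral_cst// [X in (_ * X)%E](@probability_setT _ _ _ mu) mule1 lte_fin.
  apply: ge0_le_integral => //.
  - by move=> x _; rewrite lee_fin ltW.
  - by apply/measurable_EFinP; exact: measurable_roof.
  - by move=> x _; rewrite lee_fin.
have : (0 <= (\int[mu]_x (tau x)%:E)^-1)%E by rewrite inve_ge0 ltW.
have : ((\int[mu]_x (tau x)%:E)^-1 != +oo)%E by rewrite inve_eqy gt_eqF.
rewrite /m /susp_measure.
case: (_^-1)%E => // r _; rewrite lee_fin => r0.
by exists (NngNum r0); apply/funext => B; rewrite muleC.
Qed.

Let m0 : m set0 = 0%E.
Proof.
have [r ->] := mE.
by rewrite preimage_set0 setI0 measure0 mule0.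
Qed.

Let m_ge0 B : (0 <= m B)%E.
Proof. by have [r ->] := mE; rewrite mule_ge0// lee_fin. Qed.

Let m_sigma_additive : semi_sigma_additive m.
Proof.
have [r ->] := mE => F mF tF mUF.
have -> : [set p | under_roof p] `&` susp_pi @^-1` (\bigcup_n F n) =
    \bigcup_n ([set p | under_roof p] `&` susp_pi @^-1` (F n)).
  by rewrite preimage_bigcup setI_bigcupr.
apply: (@measure_semi_sigma_additive _ _ _
  (mscale r (mu \x @lebesgue_measure R)%E)
  (fun n => [set p | under_roof p] `&` susp_pi @^-1` (F n))) => //.
- apply/trivIsetP => i j _ _ ij.
  move/trivIsetP : tF => /(_ _ _ Logic.I Logic.I ij) FF.
  have e : susp_pi @^-1` F i `&` susp_pi @^-1` F j = set0.
    by rewrite -preimage_setI FF preimage_set0.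
  by rewrite setIACA e setI0.
- by apply: bigcup_measurable => i _; exact: mF.
Qed.

HB.instance Definition _ := isMeasure.Build _ _ _ (susp_measure mu)
  m0 m_ge0 m_sigma_additive.

End Measure.

Definition birkhoff (k : nat) (x : T) : R := \sum_(j < k) tau (iter j f x).

(* For [0 <= u] this is the unique such [k], see [lapP] and [lap_unique]. *)
Definition lap (x : T) (u : R) : nat :=
  xget 0%N [set k | birkhoff k x <= u < birkhoff k.+1 x].

Definition flow_fun (s : R) (p : T * R) : T * R :=
  let k := lap p.1 (p.2 + s) in (iter k f p.1, p.2 + s - birkhoff k p.1).

(* Semiflow: meaningful for [0 <= s] only. It does not depend on the chosen
   representative, see [flow_susp_pi]. *)
Definition flow (s : R) (c : susp) : susp :=
  susp_pi (flow_fun s (val (repr c : region))).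

Lemma susp_piE (p : region) : susp_pi (val p) = \pi_susp p.
Proof. by rewrite /susp_pi valK. Qed.

Lemma birkhoffS k x : birkhoff k.+1 x = tau x + birkhoff k (f x).
Proof.
rewrite /birkhoff big_ord_recl; congr (_ + _).
by apply: eq_bigr => j _; rewrite -iterSr.
Qed.

Lemma birkhoff_le x : {homo birkhoff^~ x : k l / (k <= l)%N >-> k <= l}.
Proof.
apply: homo_leq => // [y z w|k]; first exact: le_trans.
by rewrite /birkhoff big_ord_recr /= lerDl ltW ?roof_gt0.
Qed.

Lemma lapP x u : 0 <= u -> birkhoff (lap x u) x <= u < birkhoff (lap x u).+1 x.
Proof.
move=> u0; apply: (@xgetPex _ 0%N [set k | birkhoff k x <= u < birkhoff k.+1 x]).
have [c c0 cle] := roof_bounded tau.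
have ex : exists n, u < birkhoff n x.
  exists (Num.bound (u / c)).
  have /archi_boundP : 0 <= u / c by rewrite divr_ge0// ltW.
  rewrite ltr_pdivrMr// => /lt_le_trans; apply.
  rewrite mulr_natl /birkhoff -[X in _ *+ X]card_ord -sumr_const.
  by apply: ler_sum => j _.
case: (ex_minnP ex) => -[|n] un nmin.
  by move: un; rewrite /birkhoff big_ord0 ltNge u0.
exists n; rewrite /= un andbT leNgt; apply/negP => /nmin.
by rewrite ltnn.
Qed.

Lemma lap_unique x u k : birkhoff k x <= u < birkhoff k.+1 x -> lap x u = k.
Proof.
move=> /andP[ku uk].
have u0 : 0 <= u.
  by apply: le_trans ku; rewrite sumr_ge0// => j _; rewrite ltW ?roof_gt0.
have /andP[lu ul] := lapP x u0.
apply/eqP; rewrite eqn_leq; apply/andP; split; rewrite leqNgt; apply/negP.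
  by move=> /(birkhoff_le x); rewrite leNgt (le_lt_trans lu uk).
by move=> /(birkhoff_le x); rewrite leNgt (le_lt_trans ku ul).
Qed.

Lemma flow_fun_glue s p q : 0 <= s -> glue p q ->
  flow_fun s (val p) = flow_fun s (val q).
Proof.
case: p q => -[x t] xt [[y r] yr] s0 [/= -> [-> ->]]; rewrite /flow_fun /= add0r.
have /andP[l1 l2] := lapP (f x) s0.
have -> : lap x (tau x + s) = (lap (f x) s).+1.
  by apply: lap_unique; rewrite !(birkhoffS _ x) lerD2l ltrD2l l1.
by rewrite -iterSr birkhoffS opprD addrACA subrr add0r.
Qed.

Lemma flow_susp_pi s p : 0 <= s -> under_roof p ->
  flow s (susp_pi p) = susp_pi (flow_fun s p).
Proof.
move=> s0 pR; rewrite /flow -[p]/(val (exist under_roof p pR : region)) susp_piE.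
congr susp_pi; set q := exist _ _ _.
have ind a b : clos_refl_sym_trans region glue a b ->
    flow_fun s (val a) = flow_fun s (val b).
  elim=> {a b} [a b|//|a b _ ->|a b c _ -> _ ->] //; exact: flow_fun_glue.
have /eqmodP/asboolP : repr (\pi_susp q) = q %[mod susp] by rewrite reprK.
exact: ind.
Qed.

Definition escape_time (A : set susp) (c : susp) : \bar R :=
  ereal_inf [set s%:E | s in [set s : R | 0 < s /\ ~ A (flow s c)]].

Definition hitting_time (A : set susp) (c : susp) : \bar R :=
  ereal_inf
    [set s%:E | s in [set s : R | (escape_time A c < s%:E)%E /\ A (flow s c)]].

(* The image in the quotient of [I `*` `[t1, t2]], a subset of the region under
   the roof as soon as [0 <= t1] and [t2 <= tau x] on [I]. *)
Definition cylinder (I : set T) (t1 t2 : R) : set susp :=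
  susp_pi @` (I `*` `[t1, t2]).

(* The points [x] of [I] above which the top of [I `*` `[t1, t2]] is identified
   with its bottom when [t1 = 0]: the orbit of [x] then goes through the top of
   the cylinder and back into its bottom without leaving it. *)
Definition self_glued (I : set T) (t1 t2 : R) : set T :=
  [set x | [/\ I x, I (f x), t1 = 0 & tau x = t2]].

End Suspension.

Arguments cylinder {d T R} f tau I t1 t2.

(* Main.v *)
From Stdlib Require Import Relation_Operators.
Require Import Defs.
From mathcomp Require Import all_boot all_order all_algebra.
From mathcomp Require Import generic_quotient.
From mathcomp Require Import all_classical all_reals all_analysis.
From mathcomp Require Import measurable_realfun ring lra.

(** Write [w = t2 - t1], let [x] be in [I] and let [n] be the first return time of
[x] to [I] under [f].  An orbit of the semiflow that starts at [(x, t)] with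
[t1 < t < t2] only climbs above [x], then above [f x], and so on.  It leaves the
cylinder [A] at the height [t2], so the escape time is [t2 - t]
([escape_timeE]); it next meets [A] when it reaches the height [t1] above
[iter n f x], so the hitting time is [S x + t1 - t], where [S x] is the sum of the
roof over [x, f x, ..., iter n.-1 f x] ([hitting_timeE]).

The normalized measure on [A] is the product measure divided by [mu I * w]
([integral_cylinder]).  As [t] has mean [(t1 + t2) / 2], the mean escape time is
[w / 2] and the mean return time is the average of [S] over [I] minus [w / 2].
Kac's formula ([kac]) says that [S] has over [I] the same integral as the roof has
over the whole space: each point is reached exactly once, from its last visit to
[I], and ergodicity provides this visit almost everywhere.  The mean return time
is thus [(\int tau) / mu I - w / 2].  Since the measure of [A] is
[mu I * w / \int tau], the three expressions of the theorem agree by elementary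
algebra, and the last one is affine in [\int tau] with slope [1 / mu I].

The identifications are what requires care.  A cylinder reaching the roof also
contains base points, through which an orbit may meet it without entering it.
Membership is therefore decided on the representative lying strictly below the
roof ([normal_form]), which shows that such contacts occur only at the very moment
of escape ([return_lower]).  The exceptional points form a null set on which the
times are arbitrary, possibly non-measurable, functions; it is removed by
[ge0_integral_setD_null], which holds for any nonnegative function. *)

Set Implicit Arguments.
Unset Strict Implicit.
Unset Printing Implicit Defensive.

Import Order.TTheory GRing.Theory Num.Theory.
Import numFieldNormedType.Exports.

Local Open Scope classical_set_scope.
Local Open Scope ring_scope.
Local Open Scope ereal_scope.

(** * Recurrence *)

Section Recurrence.
Context d (T : measurableType d) (R : realType).
Implicit Types (f g : T -> T) (mu : probability T R) (I : set T).

Lemma measurable_iter f k :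
  measurable_fun [set: T] f -> measurable_fun [set: T] (iter k f).
Proof.
move=> mf; elim: k => [|k ih]; first exact: measurable_id.
exact: (measurableT_comp mf ih).
Qed.

Lemma preimage_measurable d' (T' : measurableType d') (h : T -> T') B :
  measurable_fun [set: T] h -> measurable B -> measurable (h @^-1` B).
Proof. by move=> mf mB; rewrite -[X in measurable X]setTI; exact: mf. Qed.

Lemma preserves_iter f mu k : measurable_fun [set: T] f ->
  preserves f mu -> preserves (iter k f) mu.
Proof.
move=> mf fmu; elim: k => [|k ih] B mB //=.
rewrite [X in mu X](_ : _ = iter k f @^-1` (f @^-1` B))// ih ?fmu//.
exact: preimage_measurable.
Qed.

Lemma preserves_inverse f g mu : measurable_fun [set: T] g ->
  cancel f g -> preserves f mu -> preserves g mu.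
Proof.
move=> mg fK fmu B mB; rewrite -fmu; last exact: preimage_measurable.
by congr (mu _); apply/seteqP; split=> x /=; rewrite fK.
Qed.

Lemma ergodic_inverse f g mu : cancel f g -> ergodic f mu -> ergodic g mu.
Proof.
move=> fK erg B mB gB; apply: erg => //.
by rewrite -[in LHS]gB; apply/seteqP; split=> x /=; rewrite fK.
Qed.

Lemma measurable_visits f I n : measurable_fun [set: T] f -> measurable I ->
  measurable (\bigcup_k iter (k + n) f @^-1` I).
Proof.
move=> mf mI; apply: bigcup_measurable => k _.
exact/preimage_measurable/mI/measurable_iter.
Qed.

(** The sets of points that visit [I] at some time [>= n] are the successive
preimages of the first one; they decrease and, by invariance, have the same
measure.  Their intersection is thus strictly invariant and has at least the
measure of [I], so ergodicity leaves only the value 1.  The detour through the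
intersection is needed because [ergodic] asks for [f @^-1` B = B], whereas the
set of points visiting [I] only contains its preimage. *)
Lemma ergodic_visits f mu I : measurable_fun [set: T] f -> preserves f mu ->
  ergodic f mu -> measurable I -> 0 < mu I ->
  mu (\bigcap_n \bigcup_k iter (k + n) f @^-1` I) = 1.
Proof.
move=> mf fmu erg mI I0; set V := fun n => \bigcup_k iter (k + n) f @^-1` I.
have mV n : measurable (V n) by exact: measurable_visits.
have mW : measurable (\bigcap_n V n) by exact: bigcap_measurable.
have VS n : f @^-1` V n = V n.+1.
  apply/seteqP; split=> x [k _ /= kx]; exists k => //=.
    by rewrite addnS iterSr.
  by rewrite -iterSr -addnS.
have VSsub n : V n.+1 `<=` V n.
  by move=> x [k _ kx]; exists k.+1; rewrite // addSnnS.
have muV n : mu (V n) = mu (V 0%N).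
  by elim: n => // n <-; rewrite -VS fmu.
have muW : mu (\bigcap_n V n) = mu (V 0%N).
  have nV : nonincreasing_seq V.
    by apply/nonincreasing_seqP => n; exact/subsetPset/VSsub.
  have := @nonincreasing_cvg_mu _ _ _ mu V _ mV mW nV.
  rewrite ltey_eq fin_num_measure// => /(_ isT).
  have -> : mu \o V = cst (mu (V 0%N)) by apply/funext => n /=.
  move/cvg_unique; apply=> //; exact: cvg_cst.
have [] // := erg _ mW.
  rewrite preimage_bigcap; apply/seteqP; split=> x Wx n _.
    by apply: VSsub; rewrite -VS; exact: Wx.
  by have := Wx n.+1 Logic.I; rewrite -VS.
rewrite muW => V0; suff : mu I <= 0 by rewrite leNgt I0.
rewrite -V0; apply: le_measure; rewrite ?inE//.
by move=> x Ix; exists 0%N.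
Qed.

End Recurrence.

(** * Kac's formula *)

Lemma integral_preserved d (T : measurableType d) (R : realType) (f : T -> T)
    (mu : probability T R) (D : set T) (h : T -> \bar R) :
  measurable_fun [set: T] f -> preserves f mu -> measurable D ->
  measurable_fun D h -> (forall x, 0 <= h x) ->
  \int[mu]_(x in f @^-1` D) h (f x) = \int[mu]_(y in D) h y.
Proof.
move=> mf fmu mD mh h0.
rewrite -(ge0_integral_pushforward mf)//.
by apply: eq_measure_integral => B mB _; exact: fmu.
Qed.

Section Kac.
Context d (T : measurableType d) (R : realType).
Variables (f g : T -> T) (mu : probability T R) (I : set T).
Hypotheses (mf : measurable_fun [set: T] f) (mg : measurable_fun [set: T] g).
Hypothesis fK : cancel f g.
Hypotheses (fmu : preserves f mu) (erg : ergodic f mu).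
Hypotheses (mI : measurable I) (I0 : 0 < mu I).

(** The points that have not come back to [I] during the times 1 to [k]; on [I],
this means that the first return time exceeds [k]. *)
Definition away (k : nat) : set T :=
  [set x | forall j, (0 < j <= k)%N -> ~ I (iter j f x)].

(** The level [k] of the Kakutani tower over [I]: the points whose last visit to
[I], present time included, occurred [k] steps ago. *)
Definition tower (k : nat) : set T :=
  [set y | I (iter k g y) /\ forall j, (j < k)%N -> ~ I (iter j g y)].

Lemma iter_cancel k : cancel (iter k f) (iter k g).
Proof. by elim: k => // k ih x; rewrite iterSr /= fK ih. Qed.

Lemma measurable_away k : measurable (away k).
Proof.
rewrite (_ : away k =
    \bigcap_(j in [set j | (0 < j <= k)%N]) ~` (iter j f @^-1` I)).
  apply: bigcap_measurableType => j _.
  exact/measurableC/preimage_measurable/mI/measurable_iter.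
by [].
Qed.

Lemma measurable_tower k : measurable (tower k).
Proof.
rewrite (_ : tower k = iter k g @^-1` I `&`
    \bigcap_(j in [set j | (j < k)%N]) ~` (iter j g @^-1` I))//.
apply: measurableI; first exact/preimage_measurable/mI/measurable_iter.
apply: bigcap_measurableType => j _.
exact/measurableC/preimage_measurable/mI/measurable_iter.
Qed.

Lemma tower_disjoint : trivIset [set: nat] tower.
Proof.
apply/trivIsetP => i j _ _; wlog ij : i j / (i < j)%N => [hw ne|_].
  have := ne; rewrite neq_ltn => /orP[|] h; first exact: hw.
  by rewrite setIC; apply: hw => //; rewrite eq_sym.
by apply/seteqP; split=> // y [[yi _] [_ /(_ i ij)]].
Qed.

Lemma preimage_tower k : iter k f @^-1` tower k = I `&` away k.
Proof.
apply/seteqP; split=> x /=; rewrite /tower /away /= iter_cancel.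
- move=> [Ix xk]; split=> // j /andP[j0 jk] Ij.
  apply: (xk (k - j)%N); first by rewrite ltn_subrL j0 (leq_trans j0 jk).
  by rewrite -{2}(subnK jk) iterD iter_cancel.
- move=> [Ix xk]; split=> // j jk.
  rewrite -{1}(subnKC (ltnW jk)) iterD iter_cancel; apply: xk.
  by rewrite subn_gt0 jk leq_subr.
Qed.

(** The levels cover every point whose past meets [I], and recurrence of the
inverse map [g] makes these points have full measure. *)
Lemma tower_cover : mu (~` \bigcup_k tower k) = 0.
Proof.
have ergV := ergodic_visits mg (preserves_inverse mg fK fmu)
  (ergodic_inverse fK erg) mI I0.
set W := \bigcap_n _ in ergV.
have mW : measurable W.
  by apply: bigcap_measurableType => // n _; exact: measurable_visits.
apply: (@subset_measure0 _ _ _ mu _ (~` W)).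
- exact/measurableC/bigcup_measurable/(fun k _ => measurable_tower k).
- exact: measurableC.
- apply: subsetC => y /(_ 0%N Logic.I)[k _ /=]; rewrite addn0 => Ik.
  have ex : exists k, `[< I (iter k g y) >] by exists k; exact/asboolP.
  case: (ex_minnP ex) => m /asboolP Im mmin; exists m => //; split=> // j jm.
  by move=> Ij; have := mmin j; rewrite leqNgt jm => /(_ (asboolT Ij)).
- by rewrite [LHS](probability_setC mu mW) ergV subee.
Qed.

(** Kac's formula in weighted form: the sum under the integral is that of [h]
along the orbit of [x] before its first return to [I].  Its term of index [k] is
the function [h] on the level [k] of the tower, pulled back by [iter k f], and
the levels partition the space up to a null set. *)
Lemma kac (h : T -> \bar R) :
  measurable_fun [set: T] h -> (forall x, 0 <= h x) ->
  \int[mu]_(x in I) (\sum_(0 <= k <oo) h (iter k f x) * (\1_(away k) x)%:E) =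
  \int[mu]_x h x.
Proof.
move=> mh h0.
have mU : measurable (\bigcup_k tower k).
  exact/bigcup_measurable/(fun k _ => measurable_tower k).
have mfk k := measurable_iter k mf.
have mhk k : measurable_fun [set: T]
    (fun x => h (iter k f x) * (\1_(away k) x)%:E).
  apply: emeasurable_funM; first exact: measurableT_comp.
  exact/measurable_EFinP/measurable_indic/measurable_away.
rewrite integral_nneseries//; last 2 first.
- by move=> k; exact/measurable_funTS.
- by move=> k x _; rewrite mule_ge0// lee_fin.
transitivity (\sum_(0 <= k <oo) \int[mu]_(y in tower k) h y).
  apply: eq_eseriesr => k _.
  rewrite -(integral_preserved (mfk k) (preserves_iter k mf fmu))//; last 2 first.
  - exact: measurable_tower.
  - exact: measurable_funTS.
  rewrite preimage_tower integral_mkcondr.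
  apply: eq_integral => x _; rewrite patchE indicE.
  by case: ifPn => _; rewrite ?mule1 ?mule0.
rewrite -ge0_integral_bigcup//; last 3 first.
- exact: measurable_tower.
- exact: measurable_funTS.
- exact: tower_disjoint.
rewrite [RHS](@ge0_negligible_integral _ _ _ _ _ (~` \bigcup_k tower k))//.
- by rewrite setTD setCK.
- exact: measurableC.
- exact: tower_cover.
Qed.

End Kac.

(** * Points of the suspension *)

Section Quotient.
Context d (T : measurableType d) (R : realType).
Variables (f : T -> T) (tau : roof T R).
Local Open Scope ring_scope.
Local Notation pi := (@susp_pi _ T R f tau).
Local Notation region := [set p | under_roof tau p].

(** The representative below the roof.  Two points of the region are identified
exactly when they have the same one, which turns membership in the image of a set
under the quotient map into an explicit condition on the product. *)
Definition normal_form (p : T * R) : T * R :=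
  if p.2 == tau p.1 then (f p.1, 0) else p.

Lemma normal_form_id p : p.2 < tau p.1 -> normal_form p = p.
Proof. by move=> h; rewrite /normal_form lt_eqF. Qed.

Lemma susp_piP p q (hp : under_roof tau p) (hq : under_roof tau q) :
  pi p = pi q <-> susp_rel f (exist (under_roof tau) p hp)
                             (exist (under_roof tau) q hq).
Proof.
have e r (hr : under_roof tau r) :
    pi r = \pi_(susp f tau)%qT (exist (under_roof tau) r hr).
  by rewrite -(susp_piE f (exist (under_roof tau) r hr)).
by rewrite (e p hp) (e q hq); split=> [/eqmodP//|?]; exact/eqmodP.
Qed.

Lemma susp_pi_top x : pi (x, tau x) = pi (f x, 0).
Proof.
have h1 : under_roof tau (x, tau x) by rewrite /under_roof /= lexx ltW ?roof_gt0.
have h2 := under_roof_base tau (f x).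
by apply/(susp_piP h1 h2)/asboolP/rst_step.
Qed.

Lemma susp_pi_normal_form p : pi (normal_form p) = pi p.
Proof.
by rewrite /normal_form; case: eqP => //; case: p => x t /= ->; rewrite susp_pi_top.
Qed.

Lemma eq_susp_pi p q : under_roof tau p -> under_roof tau q ->
  pi p = pi q <-> normal_form p = normal_form q.
Proof.
move=> pR qR; split => [|e]; last first.
  by rewrite -susp_pi_normal_form e susp_pi_normal_form.
move=> /(susp_piP pR qR)/asboolP.
suff ind a b : clos_refl_sym_trans _ (@Defs.glue _ T R f tau) a b ->
  normal_form (val a) = normal_form (val b) by exact: ind.
elim=> {a b} [a b|//|a b _ ->|a b c _ -> _ ->] //.
case=> ea eb; rewrite /normal_form ea eqxx eb /=.
by rewrite lt_eqF ?roof_gt0.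
Qed.

Lemma susp_pi_image p (B : set (T * R)) : B `<=` region -> under_roof tau p ->
  (pi @` B) (pi p) <-> (normal_form @` B) (normal_form p).
Proof.
move=> BR pR; split=> -[q Bq e]; exists q => //; apply/eq_susp_pi => //; exact: BR.
Qed.

Lemma flow_base (s t : R) x (k := lap f tau x (t + s)) :
  0 <= s -> 0 <= t <= tau x ->
  flow s (pi (x, t)) = pi (iter k f x, t + s - birkhoff f tau k x).
Proof. by move=> s0 xt; rewrite flow_susp_pi. Qed.

Lemma birkhoff1 x : birkhoff f tau 1 x = tau x.
Proof. by rewrite /birkhoff big_ord_recl big_ord0 addr0. Qed.

Lemma birkhoff0 x : birkhoff f tau 0 x = 0.
Proof. by rewrite /birkhoff big_ord0. Qed.

Lemma birkhoffSr k x :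
  birkhoff f tau k.+1 x = birkhoff f tau k x + tau (iter k f x).
Proof. by rewrite /birkhoff big_ord_recr. Qed.

End Quotient.

(** * Escape and hitting times *)

Section Times.
Context d (T : measurableType d) (R : realType).
Variables (f : T -> T) (tau : roof T R) (I : set T) (t1 t2 : R).
Local Open Scope ring_scope.
Local Notation pi := (@susp_pi _ T R f tau).
Local Notation region := [set p | under_roof tau p].
Local Notation A := (cylinder f tau I t1 t2).
Hypotheses (finj : injective f) (t1_ge0 : 0 <= t1) (t12 : t1 < t2).
Hypothesis (It2 : forall x, I x -> t2 <= tau x).

Lemma cylinder_region : I `*` `[t1, t2] `<=` region.
Proof.
move=> [x t] [/= Ix]; rewrite in_itv /= => /andP[t1t tt2].
by rewrite /under_roof /= (le_trans t1_ge0 t1t) (le_trans tt2 (It2 Ix)).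
Qed.

(** Besides the expected points, the cylinder contains the points of the base
that are glued to its top, when that top lies on the roof. *)
Lemma cylinder_normal_form x r : 0 <= r < tau x -> A (pi (x, r)) <->
  (I x /\ t1 <= r <= t2) \/ (r = 0 /\ exists y, [/\ I y, tau y = t2 & f y = x]).
Proof.
move=> /andP[r0 rx].
have xR : under_roof tau (x, r) by rewrite /under_roof /= r0 ltW.
rewrite /cylinder (susp_pi_image _ cylinder_region)// normal_form_id//.
split=> [[[y u] [/= Iy]]|[[Ix xr]|[r00 [y [Iy yt fyx]]]]].
- rewrite in_itv /= /normal_form /= => yu; case: eqP => [ue [<- <-]|_ [<- <-]].
    right; split=> //; exists y; split => //; apply/eqP.
    by rewrite eq_le It2// -ue andbT; case/andP: yu.
  by left.
- by exists (x, r); [split=> //=; rewrite in_itv|rewrite normal_form_id].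
- exists (y, t2); first by split=> //=; rewrite in_itv /= lexx ltW.
  by rewrite /normal_form /= yt eqxx fyx r00.
Qed.

Definition first_return (n : nat) (x : T) :=
  [/\ (0 < n)%N, I (iter n f x) & forall j, (0 < j < n)%N -> ~ I (iter j f x)].

Lemma first_return_le n x : first_return n x -> I x ->
  t2 <= birkhoff f tau n x.
Proof.
case; case: n => // n _ _ _ Ix.
rewrite birkhoffS (le_trans (It2 Ix))// lerDl.
by rewrite -(birkhoff0 f tau (f x)) birkhoff_le.
Qed.

(** This excludes every meeting of the orbit with the cylinder strictly between
the top of the cylinder and the bottom of its copy over [iter n f x].  The
delicate case is a base point glued to the top of the cylinder over some [y] in
[I]: by injectivity of [f] and minimality of [n], [y] can only be [x] itself, and
then the height is exactly [t2]. *)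
Lemma return_lower n x t s : I x -> first_return n x -> t1 <= t <= t2 ->
  0 <= s -> t2 < t + s -> A (flow s (pi (x, t))) ->
  birkhoff f tau n x + t1 <= t + s.
Proof.
move=> Ix [n0 In nI] /andP[t1t tt2] s0 t2u.
have t0 : 0 <= t by exact: le_trans t1t.
rewrite flow_base//; last by rewrite t0 (le_trans tt2)// It2.
move: t2u (addr_ge0 t0 s0); move: (t + s) => u t2u u0.
have := lapP f tau x u0; move: (lap f tau x u) => k /andP[ku uk] Ak.
have [nk|kn] := ltnP n k.
  apply: le_trans ku; apply: le_trans (birkhoff_le f tau x nk).
  by rewrite birkhoffSr lerD2l (le_trans (ltW t12))// It2.
have {Ak} : (I (iter k f x) /\ t1 <= u - birkhoff f tau k x <= t2) \/
    (u - birkhoff f tau k x = 0 /\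
      exists y, [/\ I y, tau y = t2 & f y = iter k f x]).
  apply/cylinder_normal_form => //.
  by rewrite subr_ge0 ku /= ltrBlDl -birkhoffSr.
case: k ku uk kn => [|k] ku uk kn.
  rewrite birkhoff0 subr0 => -[[_ /andP[_]]|[uz _]].
    by rewrite leNgt t2u.
  by move: (le_lt_trans (le_trans t1_ge0 (ltW t12)) t2u); rewrite uz ltxx.
move=> -[[Ik /andP[h _]]|[/eqP]].
  move: kn; rewrite leq_eqVlt => /orP[/eqP e|kn]; last by case: (nI k.+1).
  by move: h; rewrite e lerBrDl.
rewrite subr_eq0 => /eqP uE [y [Iy yt /= /finj ye]].
case: k kn ye uE {ku uk} => [_ /= ye|k kn ye uE]; last first.
  by case: (nI k.+1) => //; rewrite -ye.
by rewrite birkhoff1 -ye yt => uE; move: t2u; rewrite uE ltxx.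
Qed.

Lemma return_attained n x t : I x -> first_return n x -> t1 <= t <= t2 ->
  A (flow (birkhoff f tau n x + t1 - t) (pi (x, t))).
Proof.
move=> Ix nx /andP[t1t tt2].
have t0 : 0 <= t by exact: le_trans t1t.
rewrite flow_base; last by rewrite t0 (le_trans tt2)// It2.
  rewrite addrC subrK; set u := _ + t1.
  have -> : lap f tau x u = n.
    apply: lap_unique; rewrite lerDl t1_ge0 birkhoffSr ltrD2l.
    by rewrite (lt_le_trans t12)// It2//; case: nx.
  exists (iter n f x, t1).
    by split; [case: nx|rewrite /= in_itv /= lexx ltW].
  by rewrite /u addrC addrA addNr add0r.
by rewrite subr_ge0 (le_trans tt2)// (le_trans (first_return_le nx Ix))// lerDl.
Qed.

Lemma stays_in s x t : I x -> t1 <= t -> 0 <= s -> t + s <= t2 -> t + s < tau x ->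
  A (flow s (pi (x, t))).
Proof.
move=> Ix t1t s0 ts tsx.
have t0 : 0 <= t by exact: le_trans t1t.
rewrite flow_base//; last first.
  by rewrite t0 (le_trans _ (ltW tsx))// lerDl.
have -> : lap f tau x (t + s) = 0%N.
  by apply: lap_unique; rewrite birkhoff0 birkhoff1 tsx addr_ge0.
exists (x, t + s); last by rewrite /= birkhoff0 subr0.
by split=> //=; rewrite in_itv /= ts (le_trans t1t)// lerDl.
Qed.

(** Equality could hold only if the orbit left the top of the cylinder through
the roof and immediately entered its bottom, which is what [self_glued] means. *)
Lemma first_return_gt n x : I x -> first_return n x ->
  ~ self_glued f tau I t1 t2 x -> t2 < birkhoff f tau n x + t1.
Proof.
move=> Ix nx ng; have h := first_return_le nx Ix.
rewrite lt_neqAle (le_trans h) ?lerDl// andbT; apply/eqP => e.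
have b : birkhoff f tau n x <= t2 by rewrite e lerDl.
have t10 : t1 = 0.
  by apply/eqP; rewrite eq_le t1_ge0 andbT -(lerD2l (birkhoff f tau n x)) -e addr0.
have bE : birkhoff f tau n x = t2 by apply/eqP; rewrite eq_le b h.
apply: ng; case: nx bE => n0 In nI; case: n n0 In nI {h e b} => // n _ In nI.
rewrite birkhoffS => bE.
have tx : tau x = t2.
  apply/eqP; rewrite eq_le It2// andbT -bE lerDl.
  by rewrite -(birkhoff0 f tau (f x)) birkhoff_le.
case: n In nI bE => [|n] In nI bE; first by split.
suff : tau (f x) <= 0 by rewrite leNgt roof_gt0.
rewrite -(birkhoff1 f tau) -(lerD2l (tau x)) addr0 [leRHS]tx -bE lerD2l.
exact: birkhoff_le.
Qed.

(** The orbit stays in the cylinder up to the height [t2]; then there is a whole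
interval of heights, of positive length outside [self_glued], without any point
of the cylinder. *)
Lemma escape_timeE n x t : I x -> first_return n x ->
  ~ self_glued f tau I t1 t2 x -> t1 <= t < t2 ->
  escape_time A (pi (x, t)) = (t2 - t)%:E.
Proof.
move=> Ix nx ng /andP[t1t tt2].
have gt := first_return_gt Ix nx ng.
apply/eqP; rewrite eq_le; apply/andP; split; last first.
  apply: le_ereal_inf_tmp => _ [s [s0 nA] <-]; rewrite lee_fin leNgt.
  rewrite ltrBrDl; apply/negP => h; apply: nA.
  by apply: stays_in => //; rewrite ?ltW// (lt_le_trans h)// It2.
apply/lee_addgt0Pr => e e0.
(* Leave the top by [e'], at most half-way to the next visit. *)
pose e' := Num.min e ((birkhoff f tau n x + t1 - t2) / 2).
have e'0 : 0 < e' by rewrite lt_min e0 divr_gt0// subr_gt0.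
have e'e : e' <= e by rewrite ge_min lexx.
have e'b : e' < birkhoff f tau n x + t1 - t2.
  by rewrite gt_min ltr_pdivrMr// mulr2n mulrDr mulr1 ltrDl subr_gt0 gt orbT.
apply: (@le_trans _ _ (t2 - t + e')%:E); last by rewrite -EFinD lee_fin lerD2l.
apply: ereal_inf_lbound; exists (t2 - t + e') => //.
have s0 : 0 < t2 - t + e' by rewrite addr_gt0// subr_gt0.
split=> // /(return_lower Ix nx).
have -> : t + (t2 - t + e') = t2 + e' by lra.
rewrite t1t ltW// (ltW s0) ltrDl e'0 => /(_ isT isT isT).
by rewrite leNgt -ltrBrDl e'b.
Qed.

Lemma hitting_timeE n x t : I x -> first_return n x ->
  ~ self_glued f tau I t1 t2 x -> t1 <= t < t2 ->
  hitting_time A (pi (x, t)) = (birkhoff f tau n x + t1 - t)%:E.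
Proof.
move=> Ix nx ng ht; have /andP[t1t tt2] := ht.
have gt := first_return_gt Ix nx ng.
rewrite /hitting_time (escape_timeE Ix nx ng ht).
apply/eqP; rewrite eq_le; apply/andP; split.
  apply: ereal_inf_lbound; exists (birkhoff f tau n x + t1 - t) => //.
  split; first by rewrite lte_fin ltrD2r.
  by apply: return_attained; rewrite ?t1t ?ltW.
apply: le_ereal_inf_tmp => _ [s [es As] <-].
rewrite lte_fin ltrBlDl in es.
rewrite lee_fin lerBlDl; apply: return_lower => //; first by rewrite t1t ltW.
by rewrite -(lerD2l t) addr0 (le_trans (ltW tt2))// ltW.
Qed.

End Times.

(** * Auxiliary integrals *)

Section NullSet.
Import HBNNSimple.

(** No measurability of [phi] is assumed: the integral is a supremum over simple
functions below [phi], and cutting such a function off on [N] does not change its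
integral.  Escape and hitting times are only known off a null set, on which they
need not be measurable. *)
Lemma ge0_integral_setD_null d (T : measurableType d) (R : realType)
    (nu : {measure set T -> \bar R}) (D N : set T) (phi : T -> \bar R) :
  measurable N -> nu N = 0 -> (forall x, D x -> 0 <= phi x) ->
  \int[nu]_(x in D) phi x = \int[nu]_(x in D `\` N) phi x.
Proof.
move=> mN N0 phi0.
have patch_ge0 (E : set T) : E `<=` D -> forall x, 0 <= (phi \_ E) x.
  by move=> ED x; rewrite patchE; case: ifPn => // /set_mem /ED; exact: phi0.
have DND : D `\` N `<=` D by exact: subDsetl.
rewrite integral_mkcond [RHS]integral_mkcond.
apply/eqP; rewrite eq_le; apply/andP; split; last first.
  rewrite !ge0_integralTE//; [|exact: patch_ge0..].
  apply: ereal_sup_le => _ [h hphi <-]; exists h => // x.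
  apply: le_trans (hphi x) _; rewrite !patchE in_setD.
  case: ifPn => [/andP[->]//|_]; case: ifPn => // /set_mem; exact: phi0.
rewrite !ge0_integralTE//; [|exact: patch_ge0..].
apply: ge_ereal_sup => _ [h hphi <-].
apply: ereal_sup_ubound; exists (proj_nnsfun h (measurableC mN)).
  move=> x; rewrite -mrestrict; have := hphi x.
  rewrite !patchE in_setD in_setC.
  case: (x \in N) => //=; last by rewrite andbT.
  by rewrite andbF.
rewrite -mrestrict -integral_nnsfun; last exact: measurableC.
rewrite -integralT_nnsfun [RHS](ge0_negligible_integral mN)//.
- by rewrite setTD.
- exact/measurable_EFinP.
- by move=> x _; rewrite lee_fin.
Qed.

End NullSet.

Lemma integral_affine (R : realType) (a t1 t2 : R) : (t1 < t2)%R ->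
  \int[lebesgue_measure]_(y in `]t1, t2[) (a - y)%:E =
  ((a - (t1 + t2) / 2) * (t2 - t1))%:E.
Proof.
move=> t12; set F := (fun y : R => a * y - y ^+ 2 / 2)%R.
have dF (y : R) : is_derive y 1%R (F : R -> R^o) (a - y)%R.
  rewrite /F; apply: is_derive_eq.
  rewrite !scaler0 add0r /GRing.scale /=; lra.
rewrite -(@integral_itv_bndoo _ _ _ _ true false); last first.
  apply/measurable_EFinP/measurable_funB => //.
rewrite (@continuous_FTC2 _ _ F)//.
- rewrite -EFinB /F; congr (_%:E); lra.
- apply: continuous_subspaceT => y; apply: cvgB; [exact: cvg_cst|exact: cvg_id].
- have cF (y : R) : {for y, continuous F}.
    by apply: differentiable_continuous; apply/derivable1_diffP; exact: ex_derive.
  split=> [y _||]; first exact: ex_derive.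
    exact/cvg_at_right_filter/cF.
  exact/cvg_at_left_filter/cF.
- by move=> y _; rewrite derive1E; exact: derive_val.
Qed.

(** * The normalized measure on a cylinder *)

Section CylinderMeasure.
Context d (T : measurableType d) (R : realType).
Variables (f g : T -> T) (tau : roof T R) (mu : probability T R).
Variables (I J : set T) (t1 t2 : R).
Local Notation pi := (@susp_pi _ T R f tau).
Local Notation region := [set p | under_roof tau p].
Local Notation A := (cylinder f tau I t1 t2).
Local Notation mu2 := (mu \x @lebesgue_measure R).
Hypotheses (mf : measurable_fun [set: T] f) (mg : measurable_fun [set: T] g).
Hypotheses (fK : cancel f g) (gK : cancel g f).
Hypotheses (mI : measurable I) (mJ : measurable J).
Hypotheses (JI : J `<=` I) (IJ0 : mu (I `\` J) = 0).
Hypotheses (t1_ge0 : (0 <= t1)%R) (t12 : (t1 < t2)%R).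
Hypothesis It2 : forall x, I x -> (t2 <= tau x)%R.

(** All representatives of the points of [B]; the sigma-algebra and the measure of
the suspension are those of these sets. *)
Definition reps (B : set (susp f tau)) : set (T * R) := region `&` pi @^-1` B.

(* Where everything is computed: almost all of the cylinder, and no point of [P]
   is identified with another one. *)
Local Notation P := (J `*` `]t1, t2[%classic).

Lemma measurable_normal_form : measurable_fun [set: T * R] (normal_form f tau).
Proof.
apply: measurable_fun_ifT => //.
- apply: measurable_fun_eqr; first exact: measurable_snd.
  exact: (measurableT_comp (measurable_roof tau) measurable_fst).
- apply: measurable_fun_pair => //; exact: (measurableT_comp mf measurable_fst).
Qed.

(** Membership is read off on normal forms.  Those of the cylinder are its points
below the roof and the points of the base glued to its top; the latter form an
image under [f], which is measurable as a preimage under the inverse [g]. *)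
Lemma measurable_reps_cylinder : measurable (reps A).
Proof.
have mlt : measurable [set p : T * R | (p.2 < tau p.1)%R].
  rewrite -[X in measurable X]setTI; apply: measurable_fun_ltr => //.
  exact: (measurableT_comp (measurable_roof tau) measurable_fst).
have mtop : measurable [set x : T | tau x == t2].
  rewrite -[X in measurable X]setTI; apply: measurable_fun_eqr => //.
  exact: measurable_roof.
have -> : reps A = region `&` normal_form f tau @^-1`
    ((I `*` `[t1, t2]) `&` [set p : T * R | (p.2 < tau p.1)%R] `|`
     (g @^-1` (I `&` [set x | tau x == t2])) `*` [set 0%R]).
  rewrite /reps; apply/seteqP; split=> -[x r] [xR].
    move=> /(susp_pi_image _ (cylinder_region t1_ge0 It2) xR) [[y u] [/= Iy yu] <-].
    split=> //=; have := yu; rewrite in_itv /= => /andP[t1u ut2].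
    have := le_trans ut2 (It2 Iy); rewrite le_eqVlt => /orP[/eqP uE|ul].
      right; rewrite /normal_form /= uE eqxx /=; split=> //; rewrite fK; split=> //.
      by apply/eqP/le_anti; rewrite It2// andbT -uE.
    by left; rewrite normal_form_id.
  move=> h; split=> //.
  apply/(susp_pi_image _ (cylinder_region t1_ge0 It2) xR).
  case: h => [[h1 h2]|].
    by exists (normal_form f tau (x, r)) => //; rewrite normal_form_id.
  case: (normal_form f tau (x, r)) => y u /= [[Iy /eqP ty] ->].
  exists (g y, t2); first by split=> //=; rewrite in_itv /= lexx ltW.
  by rewrite /normal_form /= ty eqxx gK.
apply: measurableI; first exact: measurable_under_roof.
apply: preimage_measurable; first exact: measurable_normal_form.
apply: measurableU.
  by apply: measurableI => //; exact: measurableX.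
apply: measurableX => //; apply: preimage_measurable => //; exact: measurableI.
Qed.

Lemma measurable_core : measurable P.
Proof. exact: measurableX. Qed.

Lemma core_sub : P `<=` reps A.
Proof.
move=> [x t] [/= Jx]; rewrite in_itv /= => /andP[h1 h2].
have Pxt : (I `*` `[t1, t2]) (x, t).
  by split=> /=; [exact: JI|rewrite in_itv /= !ltW].
by split; [exact: cylinder_region Pxt|exists (x, t)].
Qed.

Lemma reps_cylinder_sub :
  reps A `<=` (I `*` `[t1, t2]) `|` [set p | p.2 = 0%R \/ p.2 = tau p.1].
Proof.
move=> [x r] [xR /(susp_pi_image _ (cylinder_region t1_ge0 It2) xR)].
rewrite /normal_form /=; case: eqP => [-> _|rx]; first by right; right.
move=> [[y u] [/= Iy yu]]; case: eqP => _ [<- <-]; first by right; left.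
by left.
Qed.

(** Over a point of [J], or outside [I], the section of the difference is contained
in the finite set formed by 0, the height of the roof, [t1] and [t2]. *)
Lemma reps_cylinder_null : mu2 (reps A `\` P) = 0.
Proof.
have mD : measurable (reps A `\` P).
  by apply: measurableD; [exact: measurable_reps_cylinder|exact: measurable_core].
rewrite /= /product_measure1 (ge0_negligible_integral _ _ _ _ IJ0)//.
- apply: integral0_eq => x [_ /= nIJ].
  apply: countable_lebesgue_measure0.
  apply: (@sub_countable _ _ _ [set 0%R; tau x; t1; t2]); last first.
    by apply/finite_set_countable; rewrite !finite_setU; do !split.
  apply: subset_card_le => r /xsectionP [] /reps_cylinder_sub xr nP.
  case: xr => [[/= Ix]|[/= ->|/= ->]]; [|by left; left; left|by left; left; right].
  rewrite in_itv /= => /andP[]; rewrite !le_eqVlt.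
  move=> /orP[/eqP <- _|h1 /orP[/eqP ->|h2]]; [by left; right|by right|].
  case: nP; split=> /=; last by rewrite in_itv /= h1.
  by apply: contrapT => nJ; apply: nIJ.
- exact: measurableD.
- exact: measurable_fun_xsection.
Qed.

Lemma mu_core : mu J = mu I.
Proof.
rewrite -[I in RHS](setDUK JI) measureU//.
- by rewrite [X in (_ + X)%R]IJ0 addr0.
- exact: measurableD.
- by rewrite setDIK.
Qed.

Lemma mu2_core : mu2 P = mu I * (t2 - t1)%:E.
Proof.
rewrite [LHS]product_measure1E//; congr *%E; first exact: mu_core.
by rewrite [LHS](lebesgue_measure_itv `]t1, t2[) /= lte_fin t12 -EFinB.
Qed.

Lemma mu2_reps_cylinder : mu2 (reps A) = mu I * (t2 - t1)%:E.
Proof.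
rewrite -mu2_core -[reps A in LHS](setDUK core_sub) measureU//.
- by rewrite [X in (_ + X)%R]reps_cylinder_null addr0.
- exact: measurable_core.
- by apply: measurableD; [exact: measurable_reps_cylinder|exact: measurable_core].
- by rewrite setDIK.
Qed.

(** Off the region [susp_pi] is constant, and on it the sigma-algebra of the
quotient is the one that makes it measurable. *)
Lemma measurable_susp_pi : measurable_fun [set: T * R] pi.
Proof.
move=> _ B mB; rewrite setTI.
have mR := measurable_under_roof tau.
have -> : pi @^-1` B = reps B `|` (~` region `&` pi @^-1` B).
  by rewrite /reps -setIUl setUv setTI.
apply: measurableU => //.
have -> : ~` region `&` pi @^-1` B = if point \in B then ~` region else set0.
  have pE p : ~ under_roof tau p -> pi p = point.
    by move=> h; rewrite /susp_pi insubN//; exact/negP.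
  apply/seteqP; split=> p /=.
    by move=> [h]; rewrite (pE _ h) => /mem_set ->.
  by case: ifPn => // /set_mem pB h; split=> //; rewrite (pE _ h).
by case: ifP => // _; exact: measurableC.
Qed.

Hypothesis tau_int : mu.-integrable [set: T] (fun x => (tau x)%:E).
Hypothesis I0 : 0 < mu I.

Local Notation M := (fine (\int[mu]_x (tau x)%:E)).
Local Notation muI := (fine (mu I)).
Local Notation w := (t2 - t1)%R.

Lemma mean_roofE : \int[mu]_x (tau x)%:E = M%:E.
Proof. by rewrite fineK//; exact: integrable_fin_num. Qed.

Lemma mean_roof_gt0 : (0 < M)%R.
Proof.
rewrite -lte_fin -mean_roofE.
have [c c0 cle] := roof_bounded tau.
apply: (@lt_le_trans _ _ (\int[mu]_(x in [set: T]) (c%:E))).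
  by rewrite integral_cst// [X in _ * X](@probability_setT _ _ _ mu) mule1 lte_fin.
apply: ge0_le_integral => //.
- by move=> x _; rewrite lee_fin ltW.
- by apply/measurable_EFinP; exact: measurable_roof.
- by move=> x _; rewrite lee_fin.
Qed.

Lemma mu_baseE : mu I = muI%:E.
Proof. by rewrite fineK// fin_num_measure. Qed.

Lemma mu_base_gt0 : (0 < muI)%R.
Proof. by rewrite -lte_fin -mu_baseE. Qed.

Lemma area_gt0 : (0 < muI * w)%R.
Proof. by rewrite mulr_gt0 ?mu_base_gt0// subr_gt0. Qed.

(** The density with respect to the product measure of the normalized measure on
the cylinder: the roof cancels in the normalization. *)
Definition density : {nonneg R} := NngNum (ltW (etrans (invr_gt0 _) area_gt0)).

Lemma susp_measure_cylinder : susp_measure mu A = (muI * w / M)%:E.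
Proof.
rewrite /susp_measure mu2_reps_cylinder mu_baseE mean_roofE inver.
by rewrite gt_eqF ?mean_roof_gt0// -!EFinM.
Qed.

Lemma normrestr_cylinder : normrestr (susp_measure mu) A =
  pushforward (mscale density (mrestr mu2 measurable_reps_cylinder)) pi.
Proof.
apply/funext => B.
rewrite /normrestr susp_measure_cylinder /pushforward /mscale /mrestr.
rewrite /susp_measure mean_roofE !inver gt_eqF ?mean_roof_gt0//.
rewrite gt_eqF ?divr_gt0 ?mean_roof_gt0 ?area_gt0//.
rewrite -muleA -EFinM muleC; congr (_%:E * mu2 _).
  by rewrite /= invf_div mulrA mulVf ?mul1r// gt_eqF// mean_roof_gt0.
by rewrite /reps preimage_setI setIA [in RHS]setICA setIA.
Qed.

Lemma core_preimage : pi @^-1` (pi @` P) = P.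
Proof.
apply/seteqP; split => [p|p Pp]; last by exists p.
move=> [[y u] Pq e].
have qR : under_roof tau (y, u) by have [] := core_sub Pq.
have [/= Jy] := Pq; rewrite in_itv /= => /andP[h1 h2].
have u0 : (0 < u)%R by exact: le_lt_trans h1.
have uy : (u < tau y)%R by rewrite (lt_le_trans h2)// It2//; exact: JI.
have nf r : under_roof tau r -> pi (y, u) = pi r -> r = (y, u).
  move=> rR /(eq_susp_pi f qR rR); rewrite normal_form_id// /normal_form.
  by case: eqP => // _ [_ uE]; rewrite uE ltxx in u0.
have [pR|npR] := boolP (under_roof tau p); first by rewrite (nf p).
(* Off the region, [pi] takes the value [pi (point, 0)]. *)
have pE : pi (point, 0%R) = point.
  exact: (susp_piE f (exist (under_roof tau) _ (under_roof_base tau point))).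
have e0 : pi (y, u) = pi (point, 0%R).
  by rewrite pE e /susp_pi insubN.
have := nf _ (under_roof_base tau point) e0.
by case=> _ uE; rewrite -uE ltxx in u0.
Qed.

(** Integrals over the cylinder reduce to the product measure on [P]: the rest of
the cylinder is null, whatever the function does there. *)
Lemma integral_cylinder (phi : susp f tau -> \bar R) :
  (forall c, A c -> 0 <= phi c) -> measurable_fun P (phi \o pi) ->
  \int[normrestr (susp_measure mu) A]_(c in A) phi c =
  (density%:num)%:E * \int[mu2]_(p in P) phi (pi p).
Proof.
move=> phi0 mphi.
have coreA : pi @` P `<=` A.
  move=> _ [p Pp <-]; by have [] := core_sub Pp.
have repsE B : reps (pi @` P `&` B) = P `&` pi @^-1` B.
  rewrite /reps preimage_setI core_preimage setIA; congr (_ `&` _).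
  apply/seteqP; split=> [p []//|p Pp]; split=> //; by have [] := core_sub Pp.
(* Measurability in the quotient unfolds to that of the representatives. *)
have mcore : measurable (pi @` P).
  rewrite -[pi @` P]setIT.
  change (measurable (reps (pi @` P `&` setT))).
  by rewrite repsE preimage_setT setIT; exact: measurable_core.
have mA : measurable A by exact: measurable_reps_cylinder.
pose nu := pushforward (mscale density (mrestr mu2 measurable_reps_cylinder)) pi.
rewrite normrestr_cylinder.
rewrite (@ge0_integral_setD_null _ _ _ nu A (A `\` pi @` P))//; last 2 first.
- exact: measurableD.
- rewrite /nu /pushforward /mscale /= /mrestr -[RHS](mule0 (density%:num)%:E).
  move=> _; congr (_ * _).
  apply: (@subset_measure0 _ _ _ mu2 _ (reps A `\` P)).
  + apply: measurableI; last exact: measurable_reps_cylinder.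
    apply: preimage_measurable; [exact: measurable_susp_pi|exact: measurableD].
  + apply: measurableD; [exact: measurable_reps_cylinder|exact: measurable_core].
  + by move=> p [[_ nP] pA]; split=> // Pp; apply: nP; exists p.
  + exact: reps_cylinder_null.
  exact: measurable_susp_pi.
move=> mpi; rewrite setDD (setIidr coreA).
have mphi' : measurable_fun (pi @` P) phi.
  move=> _ Y mY.
  change (measurable (reps (pi @` P `&` phi @^-1` Y))).
  by rewrite repsE; exact: (mphi measurable_core _ mY).
rewrite (ge0_integral_pushforward mpi)//; last first.
  by move=> c /set_mem /coreA; exact: phi0.
rewrite [pi @^-1` _]core_preimage.
have phi0' p : P p -> 0 <= phi (pi p).
  by move=> Pp; apply/phi0/coreA; exists p.
have -> : \int[mu2]_(p in P) phi (pi p) =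
    \int[mrestr mu2 measurable_reps_cylinder]_(p in P) (phi \o pi) p.
  apply/esym/eq_measure_integral => B mB BP.
  by rewrite -[LHS]/(mu2 (B `&` reps A)) (setIidl (subset_trans BP core_sub)).
exact: (ge0_integral_mscale (mrestr mu2 measurable_reps_cylinder)
  measurable_core density mphi phi0').
Qed.

(** The average of [t] over the interval from [t1] to [t2] is its midpoint. *)
Lemma integral_core (psi : T -> R) :
  measurable_fun [set: T] psi -> (forall x, J x -> (t2 <= psi x)%R) ->
  \int[mu2]_(p in P) (psi p.1 - p.2)%:E =
  w%:E * \int[mu]_(x in J) (psi x - (t1 + t2) / 2)%:E.
Proof.
move=> mpsi Jpsi.
have mh : measurable_fun [set: T * R] (fun p => (psi p.1 - p.2)%:E).
  apply/measurable_EFinP/measurable_funB; last exact: measurable_snd.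
  exact: (measurableT_comp mpsi measurable_fst).
rewrite integral_mkcond fubini_tonelli1; last 2 first.
- apply/(measurable_restrictT _ measurable_core); exact: measurable_funTS.
- move=> [x t]; rewrite patchE; case: ifPn => // /set_mem [/= Jx].
  rewrite in_itv /= lee_fin subr_ge0 => /andP[_ tt2].
  exact: le_trans (ltW tt2) (Jpsi _ Jx).
rewrite -ge0_integralZl//; last 3 first.
- by apply/measurable_EFinP/measurable_funB => //; exact: measurable_funTS.
- move=> x Jx; rewrite lee_fin subr_ge0; apply: le_trans (Jpsi _ Jx).
  by rewrite ler_pdivrMr// mulr_natr mulr2n lerD2r ltW.
- by rewrite lee_fin subr_ge0 ltW.
rewrite [RHS]integral_mkcond; apply: eq_integral => x _.
rewrite /fubini_F [RHS]patchE; case: ifPn => xJ.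
  rewrite -EFinM mulrC -integral_affine// [RHS]integral_mkcond.
  apply: eq_integral => t _; rewrite !patchE in_setX /= xJ /=.
  by [].
apply: integral0_eq => t _; rewrite patchE in_setX /= (negbTE xJ).
by [].
Qed.

(** Both times have this form on [P]: the next relevant height [psi x] above the
base point, minus the current height. *)
Lemma mean_time (phi : susp f tau -> \bar R) (psi : T -> R) :
  (forall c, A c -> 0 <= phi c) -> measurable_fun [set: T] psi ->
  (forall x, J x -> (t2 <= psi x)%R) ->
  (forall x t, J x -> (t1 < t < t2)%R -> phi (pi (x, t)) = (psi x - t)%:E) ->
  \int[normrestr (susp_measure mu) A]_(c in A) phi c =
  (muI^-1)%:E * \int[mu]_(x in J) (psi x - (t1 + t2) / 2)%:E.
Proof.
move=> phi0 mpsi Jpsi phiE.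
have phiP p : P p -> phi (pi p) = (psi p.1 - p.2)%:E.
  by case: p => x t [/= Jx]; rewrite in_itv /=; exact: phiE.
have mphi : measurable_fun P (phi \o pi).
  apply: (eq_measurable_fun (fun p : T * R => (psi p.1 - p.2)%:E)).
    by move=> p /set_mem Pp /=; rewrite phiP.
  apply/measurable_EFinP/measurable_funTS/measurable_funB; last first.
    exact: measurable_snd.
  exact: (measurableT_comp mpsi measurable_fst).
rewrite integral_cylinder//.
have -> : \int[mu2]_(p in P) phi (pi p) = \int[mu2]_(p in P) (psi p.1 - p.2)%:E.
  by apply: eq_integral => p /set_mem Pp; rewrite phiP.
rewrite integral_core// muleA -EFinM; congr (_%:E * _).
by rewrite /= invfM -mulrA mulVf ?mulr1// gt_eqF// subr_gt0.
Qed.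

Lemma mean_escape_time :
  (forall x t, J x -> (t1 < t < t2)%R ->
     escape_time A (pi (x, t)) = (t2 - t)%:E) ->
  \int[normrestr (susp_measure mu) A]_(c in A) escape_time A c = (w / 2)%:E.
Proof.
move=> eE; rewrite (@mean_time _ (cst t2))//; last first.
  move=> c _; apply: le_ereal_inf_tmp => _ [s [s0 _] <-].
  by rewrite lee_fin ltW.
have -> : (fun x : T => (cst t2 x - (t1 + t2) / 2)%:E) = cst (w / 2)%:E.
  by apply/funext => x /=; congr (_%:E); lra.
rewrite integral_cst// [X in _ * (_ * X)]mu_core mu_baseE -!EFinM mulrCA.
by rewrite mulVf ?mulr1// gt_eqF// mu_base_gt0.
Qed.

End CylinderMeasure.

(** * The mean return time *)

Section ReturnSum.
Context d (T : measurableType d) (R : realType).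
Variables (f : T -> T) (tau : roof T R) (I : set T).
Hypotheses (mf : measurable_fun [set: T] f) (mI : measurable I).

(** The sum of the roof along the orbit of [x] before its first return to [I],
written as a series so that it is measurable and enters Kac's formula without
splitting [I] according to the return time. *)
Definition return_sum (x : T) : \bar R :=
  \sum_(0 <= k <oo) (tau (iter k f x))%:E * (\1_(away f I k) x)%:E.

Lemma return_sum_term_ge0 k x :
  0 <= (tau (iter k f x))%:E * (\1_(away f I k) x)%:E.
Proof. by rewrite mule_ge0// lee_fin// ltW ?roof_gt0. Qed.

Lemma measurable_return_sum : measurable_fun [set: T] return_sum.
Proof.
apply: (@ge0_emeasurable_sum _ _ _ _ _ predT) => [k x _ _|k _].
  exact: return_sum_term_ge0.
apply: emeasurable_funM; apply/measurable_EFinP.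
  exact: (measurableT_comp (measurable_roof tau) (measurable_iter k mf)).
exact/measurable_indic/measurable_away.
Qed.

Lemma return_sumE n x : first_return f I n x ->
  return_sum x = (birkhoff f tau n x)%:E.
Proof.
move=> [n0 In nI]; rewrite /return_sum (nneseries_split 0 n); last first.
  by move=> k _; exact: return_sum_term_ge0.
rewrite eseries0 ?adde0; last first.
  move=> k; rewrite add0n => nk _.
  rewrite indicE memNset ?mule0// => /(_ n); rewrite n0 nk; exact.
rewrite add0n big_mkord /birkhoff -sumEFin; apply: eq_bigr => k _.
rewrite indicE mem_set ?mule1// => j /andP[j0 jk]; apply: nI.
by rewrite j0 (leq_ltn_trans jk).
Qed.

End ReturnSum.

Section Main.
Context d (T : measurableType d) (R : realType).
Variables (f : T -> T) (mu : probability T R) (I : set T) (t1 t2 : R).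
Hypotheses (f_bimeas : bimeasurable f) (f_mu : preserves f mu).
Hypotheses (f_ergodic : ergodic f mu) (mI : measurable I).
Hypotheses (t1_ge0 : (0 <= t1)%R) (t12 : (t1 < t2)%R).

Definition recurrent : set T := \bigcap_n \bigcup_k iter (k + n) f @^-1` I.

Lemma recurrent_first_return x : recurrent x -> exists n, first_return f I n x.
Proof.
move=> /(_ 1%N Logic.I)[k _ /= Ik].
have ex : exists n, (0 < n)%N && `[< I (iter n f x) >].
  by exists (k + 1)%N; rewrite addn1 /=; apply/asboolP; rewrite addn1 in Ik.
case: (ex_minnP ex) => n /andP[n0 /asboolP In] nmin; exists n; split=> // j.
move=> /andP[j0 jn] Ij; have := nmin j; rewrite j0 leqNgt jn.
by move=> /(_ (asboolT Ij)).
Qed.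

Section FixedRoof.
Variable tau : roof T R.
Hypothesis tau_int : mu.-integrable [set: T] (fun x => (tau x)%:E).
Hypothesis It2 : forall x, I x -> (t2 <= tau x)%R.
Hypothesis nglued : mu (self_glued f tau I t1 t2) = 0.
Hypothesis I0 : 0 < mu I.
Local Notation A := (cylinder f tau I t1 t2).
Local Notation M := (fine (\int[mu]_x (tau x)%:E)).
Local Notation w := (t2 - t1)%R.

(* The good base points: those that come back to [I] infinitely often and whose
   orbit does not pass from the top of the cylinder directly to its bottom. *)
Let J : set T := (I `&` recurrent) `\` self_glued f tau I t1 t2.

Let mf : measurable_fun [set: T] f. Proof. by case: f_bimeas. Qed.

Let mrec : measurable recurrent.
Proof. by apply: bigcap_measurableType => n _; exact: measurable_visits. Qed.

Lemma measurable_self_glued : measurable (self_glued f tau I t1 t2).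
Proof.
have [t10|t10] := eqVneq t1 0%R; last first.
  rewrite (_ : self_glued _ _ _ _ _ = set0)//.
  by apply/seteqP; split=> // x [_ _ h]; rewrite h eqxx in t10.
rewrite (_ : self_glued _ _ _ _ _ = I `&` f @^-1` I `&` [set x | tau x == t2]).
  apply: measurableI; first by apply: measurableI => //; exact: preimage_measurable.
  rewrite -[X in measurable X]setTI; apply: measurable_fun_eqr => //.
  exact: measurable_roof.
apply/seteqP; split=> x /=; first by move=> [? ? _ /eqP].
by move=> [[? ?] /eqP].
Qed.

Let mJ : measurable J.
Proof.
by apply: measurableD; [exact: measurableI|exact: measurable_self_glued].
Qed.

Let JI : J `<=` I. Proof. by move=> x [[]]. Qed.

Let IJ0 : mu (I `\` J) = 0.
Proof.
apply: (@subset_measure0 _ _ _ mu _ (self_glued f tau I t1 t2 `|` ~` recurrent)).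
- exact: measurableD.
- by apply: measurableU; [exact: measurable_self_glued|exact: measurableC].
- move=> x [Ix nJ]; have [xg|xg] := pselect (self_glued f tau I t1 t2 x).
    by left.
  by right => xr; apply: nJ.
- apply: null_set_setU => //.
  + exact: measurable_self_glued.
  + exact: measurableC.
  + rewrite [LHS](probability_setC mu mrec).
    by rewrite (ergodic_visits mf f_mu f_ergodic mI I0) subee.
Qed.

Lemma first_return_core x : J x -> exists2 n, first_return f I n x &
  [/\ I x, ~ self_glued f tau I t1 t2 x & (fine (return_sum f tau I x)) =
  birkhoff f tau n x].
Proof.
move=> [[Ix /recurrent_first_return [n nx]] ng]; exists n => //.
by split=> //; rewrite (return_sumE _ nx).
Qed.

Let finj : injective f.
Proof. by case: f_bimeas => _ [g _ [fK _]]; exact: can_inj fK. Qed.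

Lemma cylinder_escape_time :
  \int[normrestr (susp_measure mu) A]_(c in A) escape_time A c = (w / 2)%:E.
Proof.
case: f_bimeas => _ [g mg [fK gK]].
apply: (mean_escape_time mf mg fK gK mI mJ) => // x t.
move=> /first_return_core[n nx [Ix ng _]] /andP[h1 h2].
by rewrite (escape_timeE finj t1_ge0 t12 It2 Ix nx ng)// (ltW h1).
Qed.

(** The next visit starts at the height [return_sum + t1], and Kac's formula says
that the integral of [return_sum] over [I] is that of the roof. *)
Lemma cylinder_hitting_time :
  \int[normrestr (susp_measure mu) A]_(c in A) hitting_time A c =
  (M / fine (mu I) - w / 2)%:E.
Proof.
case: f_bimeas => _ [g mg [fK gK]].
have mS := measurable_return_sum tau mf mI.
pose S x := fine (return_sum f tau I x).
have mfS : measurable_fun [set: T] S by exact: measurableT_comp.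
have Jt2 x : J x -> (t2 <= S x)%R.
  move=> /first_return_core[n nx [Ix _ Sx]]; rewrite /S Sx.
  exact: first_return_le nx Ix.
rewrite (@mean_time _ _ _ f g tau mu I J _ _ mf mg fK gK mI mJ JI IJ0
   t1_ge0 t12 It2 tau_int I0 _ (fun x => S x + t1)%R)//; last 4 first.
- move=> c _; apply: le_ereal_inf_tmp => _ [s [es _] <-].
  apply: le_trans (ltW es); apply: le_ereal_inf_tmp => _ [r [r0 _] <-].
  by rewrite lee_fin ltW.
- exact: measurable_funD.
- by move=> x Jx; rewrite (le_trans (Jt2 _ Jx))// lerDl.
- move=> x t /first_return_core[n nx [Ix ng Sx]] /andP[h1 h2].
  rewrite (hitting_timeE finj t1_ge0 t12 It2 Ix nx ng) ?(ltW h1)//.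
  by rewrite -Sx.
have muJ : mu J = (fine (mu I))%:E.
  by rewrite (mu_core mI mJ JI IJ0) (mu_baseE mu mI).
have kacJ : \int[mu]_(x in J) (S x)%:E = M%:E.
  transitivity (\int[mu]_(x in J) return_sum f tau I x).
    apply: eq_integral => x /set_mem [[_ /recurrent_first_return [n nx]] _].
    by rewrite /S (return_sumE _ nx).
  transitivity (\int[mu]_(x in I) return_sum f tau I x).
    have -> : J = I `\` (I `\` J) by rewrite setDD (setIidr JI).
    rewrite -ge0_negligible_integral//.
    - exact: measurableD.
    - exact: measurable_funTS.
    - move=> x _; apply: nneseries_ge0 => k _ _; exact: return_sum_term_ge0.
  rewrite (kac mf mg fK f_mu f_ergodic mI I0 (h := fun x => (tau x)%:E)).
  - by rewrite (mean_roofE tau_int).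
  - by apply/measurable_EFinP; exact: measurable_roof.
  - by move=> x; rewrite lee_fin ltW ?roof_gt0.
(* Adding back a constant reduces the integrand to [S], without any subtraction
   of integrals. *)
have : \int[mu]_(x in J) (S x + t1 - (t1 + t2) / 2)%:E +
    \int[mu]_(x in J) (w / 2)%:E = M%:E.
  rewrite -ge0_integralD//.
  - rewrite -kacJ; apply: eq_integral => x _; rewrite -EFinD.
    by congr (_%:E); move: (S x) => s; lra.
  - move=> x Jx; rewrite lee_fin subr_ge0; apply: (@le_trans _ _ t2).
      by rewrite ler_pdivrMr// mulr_natr mulr2n lerD2r ltW.
    by rewrite (le_trans (Jt2 _ Jx))// lerDl.
  - apply/measurable_EFinP/measurable_funTS/measurable_funB => //.
    exact: measurable_funD.
  - by move=> x _; rewrite lee_fin divr_ge0// subr_ge0 ltW.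
have -> : \int[mu]_(x in J) (w / 2)%:E = (w / 2 * fine (mu I))%:E.
  by rewrite integral_cst// [X in _ * X]muJ -EFinM.
set X := \int[mu]_(x in J) _.
move: X => -[r||]// [rE]; rewrite -EFinM; congr (_%:E).
rewrite -rE mulrDl mulrC mulfK ?addrK//.
by rewrite gt_eqF// mu_base_gt0.
Qed.

End FixedRoof.

End Main.

Lemma susp_measure_cylinder_base d (T : measurableType d) (R : realType)
    (f : T -> T) (mu : probability T R) (I : set T) (t1 t2 : R)
    (tau : roof T R) :
  bimeasurable f -> measurable I -> (0 <= t1)%R -> (t1 < t2)%R ->
  mu.-integrable [set: T] (fun x => (tau x)%:E) ->
  (forall x, I x -> (t2 <= tau x)%R) ->
  susp_measure mu (cylinder f tau I t1 t2) =
  (fine (mu I) * (t2 - t1) / fine (\int[mu]_x (tau x)%:E))%:E.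
Proof.
move=> [mf [g mg [fK gK]]] mI t1_ge0 t12 tau_int It2.
have IJ0 : mu (I `\` I) = 0 by rewrite setDv measure0.
apply: (susp_measure_cylinder mf mg fK gK mI mI _ IJ0) => //.
Qed.

Lemma integral_roof_sub d (T : measurableType d) (R : realType)
    (mu : probability T R) (I : set T) (w : R) (tau : roof T R) :
  measurable I -> mu.-integrable [set: T] (fun x => (tau x)%:E) ->
  \int[mu]_x (tau x - w * \1_I x)%:E =
  (fine (\int[mu]_x (tau x)%:E) - w * fine (mu I))%:E.
Proof.
move=> mI tau_int.
have iI : mu.-integrable [set: T] (fun x => (\1_I x)%:E : \bar R).
  by apply: integrable_indic => //; exact: fin_num_measure.
have iwI : mu.-integrable [set: T] (fun x => (w * \1_I x)%:E).
  by under eq_fun do rewrite EFinM; exact: integrableZl.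
under eq_integral do rewrite EFinB.
rewrite integralB// (mean_roofE tau_int) EFinB; congr (_ - _).
under eq_integral do rewrite EFinM.
by rewrite integralZl// integral_indic// setIT EFinM -(mu_baseE mu mI).
Qed.

Theorem theorem1 (R : realType) (X : ptopologicalType)
    (mu : probability (borel X) R) (f : borel X -> borel X)
    (f_bimeas : bimeasurable f) (f_mu : preserves f mu)
    (f_ergodic : ergodic f mu)
    (I : set (borel X)) (mI : measurable I)
    (t1 t2 : R) (t1_ge0 : (0 <= t1)%R) (t1_lt_t2 : (t1 < t2)%R) :
  (forall tau : roof (borel X) R,
    mu.-integrable [set: borel X] (fun x => (tau x)%:E) ->
    (forall x, I x -> (t2 <= tau x)%R) ->
    mu (self_glued f tau I t1 t2) = 0 ->
    let A : set (susp f tau) := cylinder f tau I t1 t2 in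
    let mubar := susp_measure mu : set (susp f tau) -> \bar R in
    let mubarA := normrestr mubar A in
    0 < mubar A ->
    \int[mubarA]_(c in A) hitting_time A c =
      \int[mubarA]_(c in A) escape_time A c +
        (1 - mubar A) * ((mu I)^-1 * \int[mu]_x (tau x)%:E) /\
    \int[mubarA]_(c in A) escape_time A c +
        (1 - mubar A) * ((mu I)^-1 * \int[mu]_x (tau x)%:E) =
      lebesgue_measure `[t1, t2] / 2%:E +
        (mu I)^-1 * \int[mu]_x (tau x - (t2 - t1) * \1_I x)%:E) /\
  (exists a b : R, b != 0%R /\
    forall tau : roof (borel X) R,
      mu.-integrable [set: borel X] (fun x => (tau x)%:E) ->
      (forall x, I x -> (t2 <= tau x)%R) ->
      mu (self_glued f tau I t1 t2) = 0 ->
      let A : set (susp f tau) := cylinder f tau I t1 t2 in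
      let mubar := susp_measure mu : set (susp f tau) -> \bar R in
      let mubarA := normrestr mubar A in
      0 < mubar A ->
      \int[mubarA]_(c in A) hitting_time A c =
        a%:E + b%:E * \int[mu]_x (tau x)%:E).
Proof.
have pos (tau : roof (borel X) R) : mu.-integrable [set: borel X] (fun x => (tau x)%:E) ->
    (forall x, I x -> (t2 <= tau x)%R) ->
    0 < susp_measure mu (cylinder f tau I t1 t2) -> 0 < mu I.
  move=> tau_int It2; rewrite susp_measure_cylinder_base// (mu_baseE mu mI).
  rewrite !lte_fin => h; rewrite lt_neqAle fine_ge0// andbT.
  by apply/eqP => e; rewrite -e mul0r mul0r ltxx in h.
split.
  move=> tau tau_int It2 nglued A mubar mubarA A0.
  have I0 := pos tau tau_int It2 A0.
  have mI0 := mu_base_gt0 mI I0.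
  have M0 := mean_roof_gt0 tau_int.
  rewrite /mubarA cylinder_hitting_time// cylinder_escape_time//.
  rewrite /mubar susp_measure_cylinder_base// (integral_roof_sub _ mI tau_int).
  rewrite lebesgue_measure_itv /= lte_fin t1_lt_t2.
  have := mean_roofE tau_int; have := mu_baseE mu mI; move: mI0 M0.
  set m := fine (mu I); set M := fine _ => mI0 M0 -> ->.
  have m_neq0 := lt0r_neq0 mI0; have M_neq0 := lt0r_neq0 M0.
  rewrite !inver (negbTE m_neq0) pnatr_eq0 /= -?EFinB -?EFinM -?EFinD.
  by split; congr (_%:E); field; rewrite ?m_neq0 ?M_neq0.
(* If [I] is null then so is every cylinder over it, and any slope will do. *)
have [I0|I0] := eqVneq (mu I) 0.
  exists 0%R, 1%R; split=> [|tau tau_int It2 nglued A mubar mubarA A0].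
    exact: oner_neq0.
  by have := pos tau tau_int It2 A0; rewrite I0 ltxx.
have {}I0 : 0 < mu I by rewrite lt_neqAle eq_sym I0 measure_ge0.
have mI0 := mu_base_gt0 mI I0.
exists (- ((t2 - t1) / 2))%R, ((fine (mu I))^-1)%R.
split=> [|tau tau_int It2 nglued A mubar mubarA A0].
  by rewrite invr_neq0// gt_eqF.
rewrite /mubarA cylinder_hitting_time// (mean_roofE tau_int) -EFinM -EFinD.
by congr (_%:E); ring.
Qed.
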